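(* Let $r$ be a positive odd integer. Then $\gamma(r) < 1/2$, that is, there is a constant $c<1/2$ (depending on $r$) such that every $r$-uniform hypergraph $F$ with exactly three edges satisfies $\pi(F)\le c$.
   Context: An $r$-graph is a collection of $r$-element subsets (edges) of a vertex set. For a family $\mathcal{F}$ of $r$-graphs, $\mathrm{ex}(n,\mathcal{F})$ is the maximum number of edges in an $r$-graph on $n$ vertices containing no member of $\mathcal{F}$ as a subgraph, and the Turán density is $\pi(\mathcal{F}) = \lim_{n\to\infty}\mathrm{ex}(n,\mathcal{F})/\binom{n}{r}$. Define $\gamma(r) = \max\{\pi(F) : F \text{ is an } r\text{-graph with exactly three edges}\}$ (up to isolated vertices there are finitely many such $F$). *)

(* Defs.v *)
From HB Require Import structures.
From mathcomp Require Import all_boot all_order all_algebra.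
From mathcomp Require Import all_classical all_reals all_analysis.
Import Order.TTheory GRing.Theory Num.Theory.
Import numFieldNormedType.Exports.

Set Implicit Arguments.
Unset Strict Implicit.
Unset Printing Implicit Defensive.

Local Open Scope classical_set_scope.
Local Open Scope ring_scope.

Definition is_uniform (r : nat) (V : finType) (E : {set {set V}}) : bool :=
  [forall e in E, #|e| == r].

Record hypergraph (r : nat) := Hypergraph {
  vertices : finType;
  edges : {set {set vertices}};
  edges_uniform : is_uniform r edges
}.

(* (V, E) is a not necessarily induced subgraph of (W, G), up to isomorphism. *)
Definition contains (V W : finType) (E : {set {set V}}) (G : {set {set W}}) :
    bool :=
  [exists f : {ffun V -> W}, injectiveb f && [forall e in E, (f @: e) \in G]].

(* hypergraph r lives above the universe that the library's set accepts, so
   families are bare predicates. *)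
Definition hgfamily (r : nat) := hypergraph r -> Prop.

Definition single (r : nat) (F : hypergraph r) : hgfamily r := fun H => H = F.

Definition family_free (r : nat) (FF : hgfamily r) (W : finType)
    (G : {set {set W}}) : Prop :=
  forall F : hypergraph r, FF F -> ~~ contains (edges F) G.

(* If no G is FF-free (then some member of FF has no edge), turan_number n FF
   is the max over the empty set, 0. *)
Definition turan_number (n r : nat) (FF : hgfamily r) : nat :=
  (\max_(G : {set {set 'I_n}} | is_uniform r G && `[< family_free FF G >])
     #|G|)%N.

Definition turan_density (R : realType) (r : nat) (FF : hgfamily r) : R :=
  lim ((fun n : nat => (turan_number n FF)%:R / 'C(n, r)%:R : R) @ \oo).

Definition three_edge_densities (R : realType) (r : nat) : set R :=
  [set x | exists F : hypergraph r,
     #|edges F| = 3%N /\ x = turan_density R (single F)].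

(* g is the maximum, not only the supremum, of the densities. *)
Definition is_gamma (R : realType) (r : nat) (g : R) : Prop :=
  @three_edge_densities R r g /\ ubound (@three_edge_densities R r) g.

(* Main.v *)
(* Let A, B, C be the edges of F, let G be an F-free r-graph on n vertices, let
   x be a uniformly random map from the vertices of F to those of G, and let
   W_S(x) say that x(S) is an edge of G. With p = P(W_A), Cauchy-Schwarz over
   the values of x on A :&: B gives P(W_A W_B) >= p^2, and likewise for the other
   pairs, while P(W_A W_B W_C) = O(1/n) because only non-injective x contribute.
   Hence W_A + W_B + W_C is odd with probability at most 3p - 6p^2 + O(1/n).

   For odd r the parity condition is rigid: if f(sA) + f(sB) + f(sC) = 0 mod 2
   for all permutations s of the vertices, then f vanishes on all r-sets. A union
   bound over the N! permutations thus gives p <= N! (3p - 6p^2 + O(1/n)), and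
   in the limit this excludes p >= 1/2. Finally, isolated vertices do not change
   the density, so only finitely many F on 3r + 1 points matter. *)

Require Import Defs.
From HB Require Import structures.
From mathcomp Require Import all_boot all_order all_algebra.
From mathcomp Require Import perm zify.

Set Implicit Arguments.
Unset Strict Implicit.
Unset Printing Implicit Defensive.

(** * Rigidity of the parity condition *)

Section PermSet.
Variable T : finType.
Implicit Types (A B C S : {set T}) (s : {perm T}).

Lemma imset_permM s t S : (s * t)%g @: S = t @: (s @: S).
Proof. by rewrite -imset_comp; apply: eq_imset => x; rewrite permM. Qed.

Lemma imset_perm1 S : (1%g : {perm T}) @: S = S.
Proof. by rewrite -[RHS]imset_id; apply: eq_imset => x; rewrite perm1. Qed.

Lemma mem_imset_perm s S x : (s x \in s @: S) = (x \in S).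
Proof. by rewrite mem_imset //; apply: perm_inj. Qed.

Lemma imset_tperm_id x y S : (x \in S) = (y \in S) -> tperm x y @: S = S.
Proof.
move=> xy; apply/setP=> z; rewrite -{1}(tpermK x y z) mem_imset_perm.
by case: tpermP => [->|->|].
Qed.

(** Swapping a point of [A :\: B] with one of [B :\: A] shrinks the difference, and no step moves a
    common point. *)
Lemma perm_transport A B : #|A| = #|B| ->
  exists2 s : {perm T}, s @: A = B & forall x, x \in A :&: B -> s x = x.
Proof.
have [m] := ubnP #|A :\: B|; elim: m => // m IHm in A *.
move=> ltm eqAB; have [AB0|[a aAB]] := set_0Vmem (A :\: B).
  exists 1%g => [|x _]; last by rewrite perm1.
  rewrite imset_perm1; apply/eqP; rewrite eqEcard eqAB leqnn andbT.
  by rewrite -setD_eq0 AB0.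
have [b bBA] : exists b, b \in B :\: A.
  apply/set0Pn; rewrite -card_gt0.
  have : 0 < #|A :\: B| by rewrite card_gt0; apply/set0Pn; exists a.
  have := cardsID B A; have := cardsID A B; rewrite setIC; lia.
move: (aAB) (bBA); rewrite !inE => /andP[aB aA] /andP[bA bB].
set A' := tperm a b @: A.
have A'B : A' :\: B \subset (A :\: B) :\ a.
  apply/subsetP => z; rewrite !inE -{2}(tpermK a b z) mem_imset_perm.
  case: tpermP => [->|->|/eqP za _]; first by rewrite (negPf bA) andbF.
    by rewrite bB.
  by rewrite za.
have [||s sA' sfix] := IHm A'.
- have := subset_leq_card A'B; have := cardsD1 a (A :\: B).
  by rewrite aAB; lia.
- by rewrite card_imset //; apply: perm_inj.
exists (tperm a b * s)%g => [|x]; first by rewrite imset_permM.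
rewrite inE permM => /andP[xA xB].
have xE : tperm a b x = x.
  rewrite tpermD //; apply/eqP => e; move: xA xB;
    by rewrite -e ?(negPf bA) ?(negPf aB).
by rewrite xE sfix // inE xB -xE mem_imset_perm xA.
Qed.

(* Conjugating by permutations that stabilise [S], invariance under one
   exchange of a point of [S] with a point outside gives it for all. *)
Lemma exchange_invariant (f : {set T} -> bool) S v u :
    v \in S -> u \notin S ->
    (forall s, f (s @: (tperm v u @: S)) = f (s @: S)) ->
  forall S', #|S'| = #|S| -> f S' = f S.
Proof.
move=> vS uS fvu.
have fswap s a b : a \in s @: S -> b \notin s @: S ->
    f (tperm a b @: (s @: S)) = f (s @: S).
  move=> aS bS; pose a' := s^-1%g a; pose b' := s^-1%g b.
  have a'S : a' \in S by rewrite -(mem_imset_perm s) permKV.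
  have b'S : b' \notin S by rewrite -(mem_imset_perm s) permKV.
  pose t := (tperm v a' * tperm u b')%g.
  have tS : t @: S = S.
    by rewrite imset_permM !imset_tperm_id ?(negPf uS) ?(negPf b'S) // vS a'S.
  have tv : t v = a'.
    rewrite permM tpermL tpermD //; apply/eqP => e.
      by rewrite -e (negPf uS) in a'S.
    by rewrite e a'S in b'S.
  have tu : t u = b'.
    rewrite permM (@tpermD _ v a') ?tpermL //; apply/eqP => e.
      by rewrite -e vS in uS.
    by rewrite -e a'S in uS.
  move: t tS tv tu => t tS tv tu; have := fvu (t * s)%g.
  by rewrite -[_ @: (tperm v u @: S)]imset_permM conjgC tpermJ !imset_permM
    tS !permM tv tu !permKV.
move=> S' cS'; have [s <- _] := perm_transport (esym cS').
(* Each transposition either preserves the current set or exchanges an inner point with an outer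
   one. *)
have [ts -> _] := prod_tpermP s; elim/last_ind: ts => [|ts [a b] IHts].
  by rewrite big_nil imset_perm1.
rewrite -cats1 big_cat big_seq1 imset_permM /= -IHts.
set p := (\prod_(t <- ts) _)%g.
case aS: (a \in p @: S); case bS: (b \in p @: S).
- by rewrite imset_tperm_id ?aS ?bS.
- by rewrite fswap ?aS ?bS.
- by rewrite tpermC fswap ?aS ?bS.
- by rewrite imset_tperm_id ?aS ?bS.
Qed.

(** The swap fixes [B] and [C], so their terms cancel in the sum of two parity conditions. *)
Lemma private_point_exchange (f : {set T} -> bool) A B C v u :
    (forall s, f (s @: A) (+) f (s @: B) (+) f (s @: C) = false) ->
    v \notin B -> v \notin C -> u \notin B -> u \notin C ->
  forall s, f (s @: (tperm v u @: A)) = f (s @: A).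
Proof.
move=> fF vB vC uB uC s; have := fF s; have := fF (tperm v u * s)%g.
rewrite !imset_permM [tperm v u @: B]imset_tperm_id ?(negPf vB) ?(negPf uB) //.
rewrite [tperm v u @: C]imset_tperm_id ?(negPf vC) ?(negPf uC) //.
by do 4!case: (f _).
Qed.

(* The effect on [f] of replacing [v] by [u] in [A] and in [B] is the same:
   put [v] in the role of [p], so that neither [v] nor [u] lies in the third
   edge. *)
Lemma common_point_exchange (f : {set T} -> bool) A B C p v u :
    (forall s, f (s @: A) (+) f (s @: B) (+) f (s @: C) = false) ->
    p \in A -> p \in B -> p \notin C -> v \in A -> v \in B ->
    u \notin A -> u \notin C ->
  forall s, f (s @: (tperm v u @: A)) (+) f (s @: A)
          = f (s @: (tperm v u @: B)) (+) f (s @: B).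
Proof.
move=> fF pA pB pC vA vB uA uC s.
have tA : tperm p v @: A = A by rewrite imset_tperm_id // pA vA.
have tB : tperm p v @: B = B by rewrite imset_tperm_id // pB vB.
have tC : tperm v u @: (tperm p v @: C) = tperm p v @: C.
  rewrite imset_tperm_id // -{1}(tpermL p v) mem_imset_perm (negPf pC).
  rewrite -(@tpermD _ p v u) ?mem_imset_perm ?(negPf uC) //.
    by apply: contraNneq uA => <-.
  by apply: contraNneq uA => <-.
have := fF (tperm p v * s)%g; have := fF (tperm p v * tperm v u * s)%g.
by rewrite !imset_permM tA tB tC; do 5!case: (f _).
Qed.

(** It is enough that [f] is constant on [r]-sets, since three equal bits with even sum vanish. A
    point lying in exactly one edge can be exchanged with [u]; if there is none, a point common to
    all three edges is exchanged instead. *)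
Lemma three_edges_rigid (f : {set T} -> bool) r A B C u :
    odd r -> #|A| = r -> #|B| = r -> #|C| = r ->
    A != B -> A != C -> B != C -> u \notin A :|: B :|: C ->
    (forall s, f (s @: A) (+) f (s @: B) (+) f (s @: C) = false) ->
  f A = false.
Proof.
move=> r_odd cA cB cC nAB nAC nBC; rewrite !inE !negb_or.
move=> /andP[/andP[uA uB] uC] fF.
have fF1 := fF 1%g; rewrite !imset_perm1 in fF1.
suff fE : forall S, #|S| = r -> f S = f A.
  by move: fF1; rewrite (fE _ cB) (fE _ cC); case: (f A).
have fFB s : f (s @: B) (+) f (s @: A) (+) f (s @: C) = false.
  by rewrite [f _ (+) f (s @: A)]addbC.
have fFC s : f (s @: C) (+) f (s @: A) (+) f (s @: B) = false.
  by rewrite -addbA addbC.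
have [/exists_inP[v vA /andP[vB vC]]|/exists_inPn privA] :=
  boolP [exists v in A, (v \notin B) && (v \notin C)].
  have := exchange_invariant vA uA (private_point_exchange fF vB vC uB uC).
  by rewrite cA.
have [/exists_inP[v vB /andP[vA vC]]|/exists_inPn privB] :=
  boolP [exists v in B, (v \notin A) && (v \notin C)].
  have := exchange_invariant vB uB (private_point_exchange fFB vA vC uA uC).
  by rewrite cB => fE S cS; rewrite !fE.
have [/exists_inP[v vC /andP[vA vB]]|/exists_inPn privC] :=
  boolP [exists v in C, (v \notin A) && (v \notin B)].
  have := exchange_invariant vC uC (private_point_exchange fFC vA vB uA uB).
  by rewrite cC => fE S cS; rewrite !fE.
(* The three sets of points lying in exactly two edges have a common size k,
   and r = 2k + |A :&: B :&: C|. *)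
pose T3 := A :&: B :&: C.
have eA : #|A| = #|A :&: B :\: C| + #|A :&: C :\: B| + #|T3|.
  rewrite -(cardsID B A) -(cardsID C (A :&: B)) -/T3.
  suff -> : A :\: B = A :&: C :\: B by clear; lia.
  apply/setP => x; rewrite !inE; case xA: (x \in A); rewrite ?andbF //.
  by have := privA x xA; case: (x \in B); case: (x \in C).
have eB : #|B| = #|A :&: B :\: C| + #|B :&: C :\: A| + #|T3|.
  rewrite -(cardsID A B) -(cardsID C (B :&: A)) [B :&: A]setIC -/T3.
  suff -> : B :\: A = B :&: C :\: A by clear; lia.
  apply/setP => x; rewrite !inE; case xB: (x \in B); rewrite ?andbF //.
  by have := privB x xB; case: (x \in A); case: (x \in C).
have eC : #|C| = #|A :&: C :\: B| + #|B :&: C :\: A| + #|T3|.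
  have -> : T3 = C :&: A :&: B by rewrite /T3 setIC setIA.
  rewrite -(cardsID A C) -(cardsID B (C :&: A)) [A :&: C]setIC.
  suff -> : C :\: A = B :&: C :\: A by clear; lia.
  apply/setP => x; rewrite !inE; case xC: (x \in C); rewrite ?andbF //.
  by have := privC x xC; case: (x \in A); case: (x \in B).
have AB_gt0 : 0 < #|A :\: B|.
  rewrite lt0n cards_eq0 setD_eq0; apply: contraNN nAB => sAB.
  by rewrite eqEcard sAB cA cB /=.
have AB_sub : A :\: B \subset A :&: C :\: B.
  apply/subsetP => x; rewrite !inE => /andP[xB xA]; rewrite xB xA /=.
  by have := privA x xA; rewrite xB negbK.
have := subset_leq_card AB_sub => cAB.
(* [A != B] makes k positive, which provides [p] and [q]; [r] odd makes [#|T3|] odd, which provides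
   [v]. *)
have /and3P[ABC_gt0 ACB_gt0 T3_gt0] :
    [&& 0 < #|A :&: B :\: C|, 0 < #|A :&: C :\: B| & 0 < #|T3|].
  by move: r_odd cA cB cC eA eB eC AB_gt0 cAB; clear; lia.
have /set0Pn[v] : T3 != set0 by rewrite -card_gt0.
have /set0Pn[p] : A :&: B :\: C != set0 by rewrite -card_gt0.
have /set0Pn[q] : A :&: C :\: B != set0 by rewrite -card_gt0.
rewrite !inE => /andP[qB /andP[qA qC]] /andP[pC /andP[pA pB]].
move=> /andP[/andP[vA vB] vC].
have fAC s : f (s @: A) (+) f (s @: C) (+) f (s @: B) = false.
  by rewrite addbAC.
(* Exchanging [v] with [u] has the same effect on all three values of [f]; the effects sum to zero
   mod 2, so each is zero. *)
have eqAB := common_point_exchange fF pA pB pC vA vB uA uC.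
have eqAC := common_point_exchange fAC qA qC qB vA vC uA uB.
have := exchange_invariant vA uA; rewrite cA; apply=> // s.
have := fF s; have := fF (tperm v u * s)%g; have := eqAB s; have := eqAC s.
by rewrite !imset_permM; do 6!case: (f _).
Qed.
End PermSet.

(** * Counting maps into an F-free hypergraph *)

Section Counting.
Variables V W : finType.
Implicit Types (A B C S : {set V}) (G : {set {set W}}) (x y z : {ffun V -> W}).

(** The event W_S. Probabilities are kept as counts over all maps [x], with [#|{ffun V -> W}|] in
    the place of 1. *)
Definition maps_into G S x : bool := x @: S \in G.

Definition ffun_perm (s : {perm V}) x : {ffun V -> W} := [ffun v => x (s v)].

Lemma ffun_permK s : cancel (ffun_perm s) (ffun_perm s^-1%g).
Proof. by move=> x; apply/ffunP => v; rewrite !ffunE permKV. Qed.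

Lemma maps_into_perm G S s x :
  maps_into G S (ffun_perm s x) = maps_into G (s @: S) x.
Proof.
rewrite /maps_into -imset_comp.
by rewrite (eq_imset (g := x \o s)) // => v; rewrite ffunE.
Qed.

Lemma sum_ffun_perm (s : {perm V}) (g : {ffun V -> W} -> nat) :
  \sum_x g (ffun_perm s x) = \sum_x g x.
Proof. by rewrite [RHS](reindex_inj (can_inj (ffun_permK s))). Qed.

Lemma eq_in_maps_into G S x y :
  {in S, x =1 y} -> maps_into G S x = maps_into G S y.
Proof. by move=> xy; rewrite /maps_into (eq_in_imset xy). Qed.

(** Turns conditioning on the values over [S] into a sum over the full function space: [z] is kept
    on [S], the rest is resampled. *)
Definition mix S z x : {ffun V -> W} := [ffun v => if v \in S then z v else x v].

Lemma mixK S z x : mix S (mix S z x) (mix S x z) = z.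
Proof. by apply/ffunP => v; rewrite !ffunE; case: (v \in S). Qed.

(* (z, x) |-> (mix S z x, mix S x z) is an involution. *)
Lemma sum_mix S (g : {ffun V -> W} -> nat) :
  \sum_z \sum_x g (mix S z x) = #|{ffun V -> W}| * \sum_x g x.
Proof.
rewrite pair_bigA /=.
pose h (p : {ffun V -> W} * {ffun V -> W}) := (mix S p.1 p.2, mix S p.2 p.1).
have hK : involutive h by case=> z x; rewrite /h /= !mixK.
rewrite (reindex_inj (inv_inj hK)) /=.
rewrite (eq_bigr (fun p => g p.1)) => [|[z x] _]; last by rewrite mixK.
by rewrite -(pair_bigA _ (fun z x => g z)) exchange_big /= sum_nat_const.
Qed.

Lemma sqr_sum_le (I : finType) (d : I -> nat) :
  (\sum_i d i) ^ 2 <= #|I| * \sum_i d i ^ 2.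
Proof.
rewrite -(leq_pmul2l (ltn0Sn 1)) -mulnn big_distrlr /= big_distrr /=.
under eq_bigr => i _ do rewrite big_distrr /=.
apply: (@leq_trans (\sum_i \sum_j (d i ^ 2 + d j ^ 2))).
  by apply: leq_sum => i _; apply: leq_sum => j _; apply: nat_Cauchy.
under eq_bigr => i _ do rewrite big_split /= sum_nat_const.
by rewrite big_split /= sum_nat_const -big_distrr /= addnn mul2n.
Qed.

Lemma eq_sum_maps_into G A B : #|A| = #|B| ->
  \sum_x maps_into G A x = \sum_x maps_into G B x.
Proof.
case/perm_transport => s <- _; rewrite -(sum_ffun_perm s).
by apply: eq_bigr => x _; rewrite maps_into_perm.
Qed.

(* Cauchy--Schwarz for the degrees [d z] of the restrictions of [z] to
   [A :&: B]; by symmetry A and B give the same degrees. *)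
Lemma sum_maps_into2_ge G A B : #|A| = #|B| ->
  (\sum_x maps_into G A x) ^ 2 <=
    #|{ffun V -> W}| * \sum_x (maps_into G A x && maps_into G B x).
Proof.
move=> cAB; pose Q := #|{ffun V -> W}|; rewrite -/Q.
set a := \sum_x _; set ab := \sum_x _.
have [Q0|Q_gt0] := posnP Q.
  by rewrite /a big1 // => x _; have := card0_eq Q0 x.
pose d S z := \sum_x maps_into G S (mix (A :&: B) z x).
(* A permutation carrying [A] to [B] and fixing the common points only reshuffles the free
   coordinates. *)
have dAB z : d A z = d B z.
  have [s sA sfix] := perm_transport cAB.
  rewrite /d -(sum_ffun_perm s); apply: eq_bigr => x _.
  rewrite -sA -maps_into_perm; congr (nat_of_bool (maps_into G A _)).
  apply/ffunP => v; rewrite !ffunE sA.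
  case: (boolP (v \in A :&: B)) => [vI|vNI]; first by rewrite sfix // vI.
  case: ifP => // /[dup] svI /sfix /perm_inj sv.
  by rewrite -sv svI in vNI.
have d_sum : \sum_z d A z = Q * a by apply: sum_mix.
(* The square is read as [d A z * d B z]. Given [z] on [A :&: B], a pair [x], [y] glues to the
   single map [mix A x y], as [A] and [B] share no further point. *)
have d_sqr : \sum_z d A z ^ 2 = Q * (Q * ab).
  rewrite -(sum_mix (A :&: B)) big_distrr /=; apply: eq_bigr => z _.
  rewrite -(sum_mix A (fun u => nat_of_bool (_ && _))) -mulnn {2}dAB big_distrlr /=.
  apply: eq_bigr => x _; apply: eq_bigr => y _; rewrite mulnb.
  congr (nat_of_bool (_ && _)); apply: eq_in_maps_into => v vS.
    by rewrite !ffunE inE vS.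
  by rewrite !ffunE inE vS andbT; case: (v \in A).
have := sqr_sum_le (d A); rewrite d_sum d_sqr -/Q expnMn.
by rewrite -[Q ^ 2]mulnn !mulnA -!mulnA !(leq_pmul2l Q_gt0).
Qed.

(* If the parity condition on the three edges holds for [x] after every
   permutation of the vertices, then [x] does not map [A] to an edge, by
   rigidity; and each permutation fails for equally many [x]. *)
Lemma sum_maps_into_le_bad G r A B C u :
    odd r -> #|A| = r -> #|B| = r -> #|C| = r ->
    A != B -> A != C -> B != C -> u \notin A :|: B :|: C ->
  \sum_x maps_into G A x <= #|V|`! *
    \sum_x (maps_into G A x (+) maps_into G B x (+) maps_into G C x).
Proof.
move=> r_odd cA cB cC nAB nAC nBC uF.
pose bad x := maps_into G A x (+) maps_into G B x (+) maps_into G C x.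
rewrite -[_ * _]/(_ * \sum_x bad x).
have <- : \sum_(s : {perm V}) \sum_x bad (ffun_perm s x) = #|V|`! * \sum_x bad x.
  transitivity (\sum_(s : {perm V}) \sum_x bad x).
    by apply: eq_bigr => s _; apply: (sum_ffun_perm s (fun x => bad x : nat)).
  rewrite sum_nat_const -cardsT -card_perm; congr (_ * _); apply: eq_card => s.
  by apply/esym/subsetP => v; rewrite inE.
rewrite exchange_big /=; apply: leq_sum => x _.
case Ax: (maps_into G A x) => //.
have [/existsP[s bads]|/existsPn good] := boolP [exists s, bad (ffun_perm s x)].
  by rewrite (bigD1 s) //= bads.
have := @three_edges_rigid _ (fun S => maps_into G S x) _ _ _ _ _
  r_odd cA cB cC nAB nAC nBC uF.
rewrite Ax => -> // s; apply/negbTE.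
by rewrite -!maps_into_perm; apply: good.
Qed.

(** For bits, the parity of a + b + c is a + b + c - 2(ab + ac + bc) + 4abc; Cauchy-Schwarz bounds
    each pair term from below. *)
Lemma sum_bad_le G A B C :
    #|A| = #|B| -> #|A| = #|C| ->
  #|{ffun V -> W}| *
      \sum_x (maps_into G A x (+) maps_into G B x (+) maps_into G C x)
    + 6 * (\sum_x maps_into G A x) ^ 2
  <= 3 * ((\sum_x maps_into G A x) * #|{ffun V -> W}|)
    + 4 * (#|{ffun V -> W}| *
           \sum_x [&& maps_into G A x, maps_into G B x & maps_into G C x]).
Proof.
move=> cAB cAC; set Q := #|_|; set a := \sum_x maps_into G A x.
set bad := \sum_x (_ (+) _); set abc := \sum_x [&& _, _ & _].
have ab := sum_maps_into2_ge G cAB; have ac := sum_maps_into2_ge G cAC.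
have bc := @sum_maps_into2_ge G B C (etrans (esym cAB) cAC).
rewrite -(eq_sum_maps_into G cAB) -/Q -/a in bc; rewrite -/Q -/a in ab ac.
have : bad + 2 * (\sum_x (maps_into G A x && maps_into G B x) +
    \sum_x (maps_into G A x && maps_into G C x) +
    \sum_x (maps_into G B x && maps_into G C x)) = 3 * a + 4 * abc.
  have -> : 3 * a = \sum_x maps_into G A x + \sum_x maps_into G B x +
      \sum_x maps_into G C x.
    by rewrite -(eq_sum_maps_into G cAB) -(eq_sum_maps_into G cAC) -/a; lia.
  rewrite !mulnDr !big_distrr /= -!big_split /=; apply: eq_bigr => x _.
  by case: (maps_into G A x); case: (maps_into G B x); case: (maps_into G C x).
move/(congr1 (muln Q)).
set x := \sum_x _ in ab *; set y := \sum_x _ in ac *; set z := \sum_x _ in bc *.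
by move: ab ac bc; clearbody x y z bad abc a Q; clear; lia.
Qed.

Lemma sum_maps_into_edges G A :
  \sum_x maps_into G A x = \sum_(e in G) \sum_(x : {ffun V -> W}) (x @: A == e).
Proof.
rewrite exchange_big /=; apply: eq_bigr => x _; rewrite /maps_into.
have [xG|xG] := boolP (x @: A \in G).
  rewrite (bigD1 (x @: A)) //= eqxx big1 // => e /andP[_].
  by rewrite eq_sym => /negPf->.
by rewrite big1 // => e eG; case: eqP => // xe; rewrite xe eG in xG.
Qed.

Lemma eq_sum_imset A (e e' : {set W}) : #|e| = #|e'| ->
  \sum_(x : {ffun V -> W}) (x @: A == e) =
  \sum_(x : {ffun V -> W}) (x @: A == e').
Proof.
case/perm_transport => s <- _.
pose h x : {ffun V -> W} := [ffun v => s (x v)].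
have h_inj : injective h.
  move=> x y /ffunP xy; apply/ffunP => v; have := xy v.
  by rewrite !ffunE => /perm_inj.
rewrite [RHS](reindex_inj h_inj); apply: eq_bigr => x _.
have -> : h x @: A = s @: (x @: A).
  by rewrite -imset_comp; apply: eq_imset => v; rewrite /h ffunE.
by rewrite (inj_eq (imset_inj (@perm_inj _ s))).
Qed.

(** By symmetry of [W], all [r]-sets are images of [A] equally often, so [G] gets its proportional
    share of the maps with [#|x @: A| == r]. *)
Lemma sum_maps_into_uniform G r A : is_uniform r G ->
  (\sum_x maps_into G A x) * 'C(#|W|, r) =
  #|G| * \sum_(x : {ffun V -> W}) (#|x @: A| == r).
Proof.
move=> /forall_inP G_r; pose K := [set e : {set W} | #|e| == r].
have -> : \sum_(x : {ffun V -> W}) (#|x @: A| == r) = \sum_x maps_into K A x.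
  by apply: eq_bigr => x _; rewrite /maps_into inE.
rewrite !sum_maps_into_edges -card_draws -/K.
have [G0|[e0 e0G]] := set_0Vmem G.
  by rewrite G0 big_set0 cards0 !mul0n.
rewrite (eq_bigr (fun _ => \sum_(x : {ffun V -> W}) (x @: A == e0))); last first.
  move=> e eG; apply: eq_sum_imset.
  by rewrite (eqP (G_r e eG)) (eqP (G_r e0 e0G)).
rewrite sum_nat_const.
rewrite (eq_bigr (fun _ => \sum_(x : {ffun V -> W}) (x @: A == e0))); last first.
  move=> e; rewrite inE => /eqP e_r.
  by apply: eq_sum_imset; rewrite e_r (eqP (G_r e0 e0G)).
by rewrite sum_nat_const mulnC mulnCA mulnA.
Qed.

Lemma sum_injective :
  \sum_(x : {ffun V -> W}) injectiveb x = #|W| ^_ #|V|.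
Proof.
rewrite -card_inj_ffuns -sum1_card [RHS]big_mkcond /=.
by apply: eq_bigr => x _; rewrite inE; case: injectiveb.
Qed.

(** [a] counts the maps sending [A] to an edge. As [G] is free, a map sending all three edges to
    edges is not injective, so there are at most [Q - I] of these. *)
Lemma free_density_ineq (E : {set {set V}}) G r A B C u :
    odd r -> is_uniform r G -> is_uniform r E -> E = [set A; B; C] ->
    A != B -> A != C -> B != C -> u \notin A :|: B :|: C ->
    ~~ contains E G ->
  let Q := #|W| ^ #|V| in let I := #|W| ^_ #|V| in
  exists2 a, #|G| * I <= a * 'C(#|W|, r) <= #|G| * Q &
    a * Q + #|V|`! * (6 * a ^ 2) <=
    #|V|`! * (3 * (a * Q) + 4 * (Q * (Q - I))).
Proof.
move=> r_odd G_r /forall_inP E_r EE nAB nAC nBC uF freeG Q I.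
have AE : A \in E by rewrite EE !inE eqxx.
have BE : B \in E by rewrite EE !inE eqxx orbT.
have CE : C \in E by rewrite EE !inE eqxx !orbT.
have cA := eqP (E_r _ AE); have cB := eqP (E_r _ BE); have cC := eqP (E_r _ CE).
have QE : #|{ffun V -> W}| = Q by rewrite card_ffun.
exists (\sum_x maps_into G A x).
  rewrite (sum_maps_into_uniform _ G_r) !leq_mul2l /I -sum_injective -QE.
  apply/andP; split; apply/orP; right.
    apply: leq_sum => x _; case: injectiveP => // xinj.
    by rewrite card_imset // cA eqxx.
  by rewrite -sum1_card; apply: leq_sum => x _; apply: leq_b1.
have leA := sum_maps_into_le_bad G r_odd cA cB cC nAB nAC nBC uF.
have := sum_bad_le G (etrans cA (esym cB)) (etrans cA (esym cC)).
have : \sum_x [&& maps_into G A x, maps_into G B x & maps_into G C x] + I <= Q.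
  rewrite /I -sum_injective -QE -sum1_card -big_split /=.
  apply: leq_sum => x _; case: (boolP (injectiveb x)) => xinj; last first.
    by rewrite addn0 leq_b1.
  case: and3P => // -[xA xB xC]; case/negP: freeG.
  apply/existsP; exists x; rewrite xinj; apply/forall_inP => e.
  by rewrite EE !inE => /orP[/orP[]|] /eqP->.
move: leA; rewrite QE; clearbody Q I; set a := \sum_x maps_into G A x.
set bad := \sum_x (_ (+) _); set abc := \sum_x [&& _, _ & _].
move: #|V|`! => M; clearbody a bad abc; clear => leA leI ineq.
have le1 : Q * a <= Q * (M * bad) by rewrite leq_mul2l leA orbT.
have le2 : Q * abc <= Q * (Q - I).
  by rewrite leq_mul2l -(leq_add2r I) subnK ?leI ?orbT //; lia.
have le3 : M * (Q * bad + 6 * a ^ 2) <= M * (3 * (a * Q) + 4 * (Q * abc)).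
  by rewrite leq_mul2l ineq orbT.
have le4 : M * (Q * abc) <= M * (Q * (Q - I)) by rewrite leq_mul2l le2 orbT.
rewrite !mulnDr in le3 *; set x := Q * (Q - I) in le4 *.
move: le1 le3 le4; clearbody x; clear; lia.
Qed.
End Counting.

(** * Removing isolated vertices *)

Section PartialEmbedding.
Variables V W : finType.

Lemma injective_extension (D : {set V}) (h : V -> W) :
    #|V| <= #|W| -> {in D &, injective h} ->
  exists2 f : {ffun V -> W}, injective f & {in D, f =1 h}.
Proof.
move=> leVW hinj; pose s1 := enum (~: D); pose s2 := enum (~: (h @: D)).
have s12 : size s1 <= size s2.
  rewrite -!cardE; have := cardsC D; have := cardsC (h @: D).
  by rewrite card_in_imset //; lia.
have ltidx v : v \notin D -> index v s1 < size s1.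
  by move=> vD; rewrite index_mem mem_enum inE.
pose f := [ffun v => if v \in D then h v else nth (h v) s2 (index v s1)].
have fD v : v \notin D -> f v \notin h @: D.
  move=> vD; have := @mem_nth _ (h v) s2 _ (leq_trans (ltidx v vD) s12).
  by rewrite ffunE (negPf vD) mem_enum inE.
exists f => [v w|v vD]; last by rewrite ffunE vD.
case: (boolP (v \in D)) => vD; case: (boolP (w \in D)) => wD fvw.
- by apply: hinj => //; move: fvw; rewrite !ffunE vD wD.
- by case/negP: (fD w wD); rewrite -fvw ffunE vD imset_f.
- by case/negP: (fD v vD); rewrite fvw ffunE wD imset_f.
move: fvw; rewrite !ffunE (negPf vD) (negPf wD).
have ltv := leq_trans (ltidx v vD) s12; have ltw := leq_trans (ltidx w wD) s12.
rewrite (set_nth_default (h v) _ ltw) => /eqP.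
rewrite nth_uniq ?enum_uniq // => /eqP idx.
have vs1 : v \in s1 by rewrite mem_enum inE.
by rewrite -(nth_index v vs1) idx nth_index // mem_enum inE.
Qed.

Lemma contains_partial (E : {set {set V}}) (G : {set {set W}}) (h : V -> W) :
    #|V| <= #|W| -> {in cover E &, injective h} ->
    (forall e, e \in E -> h @: e \in G) ->
  contains E G.
Proof.
move=> leVW hinj hE; have [f finj fh] := injective_extension leVW hinj.
apply/existsP; exists f; apply/andP; split; first exact/injectiveP.
apply/forall_inP => e eE; have <- : h @: e = f @: e; last exact: hE.
apply: eq_in_imset => v ve; rewrite fh //.
by apply: (subsetP (bigcup_sup _ eE)).
Qed.

End PartialEmbedding.

(** Isolated vertices need only room in the host, so embeddings are transported along [g] and its
    inverse on covered vertices. *)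
Lemma contains_core (V V' W : finType) (E : {set {set V}})
    (G : {set {set W}}) (g : V -> V') v0 :
    #|V| <= #|W| -> #|V'| <= #|W| -> v0 \in cover E ->
    {in cover E &, injective g} ->
  contains [set g @: (e : {set V}) | e in E] G = contains E G.
Proof.
move=> leVW leV'W v0E ginj.
have sub e v : e \in E -> v \in e -> v \in cover E.
  by move=> eE ve; apply: (subsetP (bigcup_sup _ eE)).
apply/idP/idP => /existsP[f /andP[/injectiveP finj /forall_inP fE]].
  apply: (contains_partial (h := f \o g)) => // [v w vE wE /finj|e eE].
    exact: ginj.
  by rewrite imset_comp; apply: fE; apply: imset_f.
pose g' y := odflt v0 [pick v in cover E | g v == y].
have g'K : {in cover E, cancel g g'}.
  move=> v vE; rewrite /g'; case: pickP => [w /andP[wE /eqP]|/(_ v)].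
    exact: ginj.
  by rewrite vE eqxx.
apply: (contains_partial (h := f \o g')) => // [y z|_ /imsetP[e eE ->]].
  case/bigcupP=> _ /imsetP[e eE ->] /imsetP[v ve ->].
  case/bigcupP=> _ /imsetP[e' e'E ->] /imsetP[w we' ->] /= /finj.
  by rewrite !g'K ?(sub e v) ?(sub e' w) // => ->.
rewrite -imset_comp; have -> : ((f \o g') \o g) @: e = f @: e; last exact: fE.
by apply: eq_in_imset => v ve /=; rewrite g'K // (sub e).
Qed.

Lemma cover_card_le (V : finType) r (E : {set {set V}}) :
  is_uniform r E -> #|cover E| <= #|E| * r.
Proof.
move=> /forall_inP E_r; apply: leq_trans (leq_card_cover E) _.
by rewrite -sum_nat_const; apply: leq_sum => e eE; rewrite (eqP (E_r e eE)).
Qed.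

(** At most [m] points are covered, so [m.+1] points hold the edges and leave a spare one for the
    [u] of [three_edges_rigid]. *)
Lemma core_representative (V : finType) r m (E : {set {set V}}) :
    0 < r -> is_uniform r E -> E != set0 -> #|E| * r <= m ->
  exists E' : {set {set 'I_m.+1}}, [/\ is_uniform r E', #|E'| = #|E| &
    forall (W : finType) (G : {set {set W}}),
      #|V| <= #|W| -> m < #|W| -> contains E' G = contains E G].
Proof.
move=> r_gt0 E_r /set0Pn[e0 e0E] lem.
have [v0 v0E] : exists v, v \in cover E.
  have : e0 != set0 by rewrite -card_gt0 (eqP (forall_inP E_r _ e0E)).
  by case/set0Pn=> v ve0; exists v; apply/bigcupP; exists e0.
pose g v : 'I_m.+1 := inord (index v (enum (cover E))).
have ginj : {in cover E &, injective g}.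
  move=> v w vE wE /(congr1 val) /=.
  have lt_m x : x \in cover E -> index x (enum (cover E)) < m.+1.
    move=> xE; rewrite ltnS; apply: leq_trans lem.
    apply: leq_trans (cover_card_le E_r).
    by rewrite cardE ltnW // index_mem mem_enum.
  rewrite !inordK ?lt_m // => idx.
  have vs : v \in enum (cover E) by rewrite mem_enum.
  by rewrite -(nth_index v vs) idx nth_index // mem_enum.
have sub e : e \in E -> {subset e <= cover E}.
  by move=> eE; apply/subsetP/(bigcup_sup _ eE).
exists [set g @: (e : {set V}) | e in E]; split.
- apply/forall_inP => _ /imsetP[e eE ->]; rewrite card_in_imset.
    exact: (forall_inP E_r).
  by move=> v w ve we; apply: ginj; apply: (sub e).
- apply: card_in_imset => e e' eE e'E gee'; apply/setP => v.
  have mem_g x : x \in E -> v \in cover E -> (v \in x) = (g v \in g @: x).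
    move=> xE vE; apply/idP/imsetP => [vx|[w wx /ginj ->] //]; first by exists v.
    exact: (sub x).
  case: (boolP (v \in cover E)) => vE.
    by rewrite (mem_g e) // gee' -mem_g.
  rewrite (contraNF (sub e eE v) vE).
  by rewrite (contraNF (sub e' e'E v) vE).
by move=> W G leVW ltm; apply: contains_core v0E ginj; rewrite ?card_ord.
Qed.

From mathcomp Require Import all_classical all_reals all_analysis.
From mathcomp Require Import ring lra.
Import Order.TTheory GRing.Theory Num.Theory.
Import numFieldNormedType.Exports.
Local Open Scope classical_set_scope.
Local Open Scope ring_scope.

(** * Densities *)

Lemma family_free_single r (F : hypergraph r) (W : finType) (G : {set {set W}}) :
  family_free (single F) G <-> ~~ contains (edges F) G.
Proof. by split=> [|FG H ->] //; apply. Qed.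

Lemma turan_number_eq r (F H : hypergraph r) n :
    (forall G : {set {set 'I_n}}, contains (edges F) G = contains (edges H) G) ->
  turan_number n (single F) = turan_number n (single H).
Proof.
move=> FH; apply: eq_bigl => G; congr (_ && _); apply: asbool_equiv_eq.
by rewrite !family_free_single FH.
Qed.

Lemma lim_near_eq (R : realType) (u v : nat -> R) :
  (\forall n \near \oo, u n = v n) -> lim (u @ \oo) = lim (v @ \oo).
Proof.
move=> uv; congr (lim _); apply/seteqP; split; apply: near_eq_cvg => //.
by apply: filterS uv => n ->.
Qed.

(** As [F] has an edge, the empty graph is free and the maximum is over a nonempty set. *)
Lemma turan_number_attained r (F : hypergraph r) n : edges F != finset.set0 ->
  exists G : {set {set 'I_n}}, [/\ is_uniform r G, ~~ contains (edges F) G &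
    turan_number n (single F) = #|G|].
Proof.
move=> /finset.set0Pn[e eF].
have [|G] := @eq_bigmax_cond {set {set 'I_n}}
  [pred G | is_uniform r G && `[< family_free (single F) G >]] (fun G => #|G|).
  apply/card_gt0P; exists finset.set0; rewrite inE; apply/andP; split.
    by apply/forall_inP => e'; rewrite finset.in_set0.
  apply/asboolP/family_free_single/existsPn => f; rewrite negb_and.
  by apply/orP; right; apply/forall_inPn; exists e => //; rewrite finset.in_set0.
rewrite inE => /andP[G_r /asboolP/family_free_single GF] GE.
by exists G; split.
Qed.

(** This is the proportion of injective maps from m points to n points; each induction step
    contributes a factor 1 - m/n. *)
Lemma cvg_ffact_ratio (R : realType) m :
  ((fun n : nat => (n ^_ m)%:R / (n ^ m)%:R : R) @ \oo) --> (1 : R).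
Proof.
elim: m => [|m IHm].
  rewrite (_ : (fun n : nat => _) = cst 1); first exact: cvg_cst.
  by apply/funext => n; rewrite ffactn0 expn0 divr1.
have lin : ((fun n : nat => 1 - m%:R / n%:R : R) @ \oo) --> (1 : R).
  rewrite -[X in _ --> X]subr0; apply: cvgB; first exact: cvg_cst.
  rewrite -(mulr0 m%:R); apply: cvgMr.
  apply/gtr0_cvgV0; last exact: cvgr_idn.
  by near=> n; rewrite ltr0n; near: n; exists 1%N.
rewrite -[X in _ --> X]mulr1; apply: cvg_trans (cvgM IHm lin).
apply: near_eq_cvg; near=> n.
have n_gt0 : (0 < n)%N by near: n; exists 1%N.
have le_mn : (m <= n)%N by near: n; exists m.
have n_neq0 : n%:R != 0 :> R by rewrite pnatr_eq0 -lt0n.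
rewrite /= ffactnSr expnSr !natrM natrB //.
by field; rewrite natrX expf_neq0 ?n_neq0.
Unshelve. all: by end_near. Qed.

(** After division by [Q ^ 2], [p = a / Q] lies between [rho * t] and [rho], so the left side is
    lowered to [rho * t] and the right side raised to [rho]. *)
Lemma density_ineq (R : realType) (r n M a g Q I : nat) (C := 'C(n, r))
    (rho := g%:R / C%:R : R) (t := I%:R / Q%:R : R) :
    (0 < C)%N -> (0 < Q)%N -> (I <= Q)%N ->
    (g * I <= a * C <= g * Q)%N ->
    (a * Q + M * (6 * a ^ 2) <= M * (3 * (a * Q) + 4 * (Q * (Q - I))))%N ->
  rho * t + 6 * M%:R * (rho * t) ^+ 2 <= 3 * M%:R * rho + 4 * M%:R * (1 - t).
Proof.
move=> C_gt0 Q_gt0 leIQ /andP[lo hi] ineq.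
have Cp : 0 < C%:R :> R by rewrite ltr0n.
have Qp : 0 < Q%:R :> R by rewrite ltr0n.
pose p := a%:R / Q%:R : R.
have lo' : rho * t <= p.
  rewrite /rho /t /p mulrACA -invfM ler_pdivrMr ?mulr_gt0 //.
  rewrite [leRHS](_ : _ = a%:R * C%:R); last by field; rewrite gt_eqF.
  by rewrite -!natrM ler_nat.
have hi' : p <= rho.
  by rewrite /p /rho ler_pdivrMr // mulrAC ler_pdivlMr // -!natrM ler_nat.
have sqr : (rho * t) ^+ 2 <= p ^+ 2.
  by rewrite lerXn2r // nnegrE ?mulr_ge0 ?divr_ge0 ?invr_ge0 ?ler0n.
have : p + 6 * M%:R * p ^+ 2 <= 3 * M%:R * p + 4 * M%:R * (1 - t).
  have Q2 : 0 < Q%:R ^+ 2 :> R by rewrite exprn_gt0.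
  rewrite -(ler_pM2r Q2).
  have := ineq; rewrite -(ler_nat R) !(natrD, natrM, natrX) natrB //.
  congr (_ <= _); rewrite /p /t; field; by rewrite gt_eqF.
have M_ge0 : 0 <= M%:R :> R by [].
have M6 : 6 * M%:R * (rho * t) ^+ 2 <= 6 * M%:R * p ^+ 2.
  by rewrite ler_wpM2l ?mulr_ge0.
have M3 : 3 * M%:R * p <= 3 * M%:R * rho by rewrite ler_wpM2l ?mulr_ge0.
lra.
Qed.

(** If L >= 1/2, then 3ML - 6ML^2 = -3ML(2L - 1) <= 0, which forces L <= 0. *)
Lemma quadratic_lt_half (R : realType) (L M : R) :
  0 <= M -> L + 6 * M * L ^+ 2 <= 3 * M * L -> L < 2^-1.
Proof.
move=> M_ge0 ineq; rewrite ltNge; apply/negP => L_ge.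
have := mulr_ge0 M_ge0 (mulr_ge0 (_ : 0 <= L) (_ : 0 <= 2 * L - 1)).
by nra.
Qed.

Lemma cards3P (T : finType) (A : {set T}) : #|A| = 3 ->
  exists a b c, [/\ a != b, a != c, b != c & A = [set a; b; c]%SET].
Proof.
move=> A3; have [A0|[a aA]] := set_0Vmem A; first by rewrite A0 cards0 in A3.
have : #|(A :\ a)%SET| == 2 by have := cardsD1 a A; rewrite aA A3 add1n => -[<-].
case/cards2P => b [c [bc Abc]].
have : b \in (A :\ a)%SET by rewrite Abc !inE eqxx.
have : c \in (A :\ a)%SET by rewrite Abc !inE eqxx orbT.
rewrite !inE => /andP[ca _] /andP[ba _].
exists a, b, c; split; rewrite // 1?eq_sym //.
by rewrite -finset.setUA -Abc finset.setD1K.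
Qed.

Lemma turan_density_lt_half (R : realType) r (F : hypergraph r) :
    odd r -> #|edges F| = 3 -> (3 * r < #|vertices F|)%N ->
  turan_density R (single F) < 2^-1.
Proof.
move=> r_odd F3 ltF.
have [A [B [C [AB AC BC FE]]]] := cards3P F3.
have [u uF] : exists u, u \notin (A :|: B :|: C)%SET.
  have ltcov : (#|finset.cover (edges F)| < #|vertices F|)%N.
    by apply: leq_ltn_trans (cover_card_le (edges_uniform F)) _; rewrite F3.
  have /finset.set0Pn[u uc] : (~: finset.cover (edges F))%SET != finset.set0.
    by rewrite -card_gt0 cardsCs finset.setCK subn_gt0.
  exists u; move: uc; rewrite !inE; apply: contra => uABC; apply/finset.bigcupP.
  by case/orP: uABC => [/orP[]|] uX; [exists A|exists B|exists C];
    rewrite // FE !inE eqxx ?orbT.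
pose N := #|vertices F|; pose M := N`!%:R : R.
pose t (n : nat) : R := (n ^_ N)%:R / (n ^ N)%:R.
pose rho (n : nat) : R := (turan_number n (single F))%:R / 'C(n, r)%:R.
have rho_ineq : \forall n \near \oo, rho n * t n + 6 * M * (rho n * t n) ^+ 2 <=
    3 * M * rho n + 4 * M * (1 - t n).
  near=> n.
  have F0 : edges F != finset.set0 by rewrite -cards_eq0 F3.
  have [G [G_r GF GE]] := turan_number_attained n F0.
  have FU := edges_uniform F.
  have [a aG ineq] := free_density_ineq r_odd G_r FU FE AB AC BC uF GF.
  rewrite /rho GE; rewrite card_ord in aG ineq; apply: density_ineq aG ineq.
  - by rewrite bin_gt0; near: n; exists r.
  - by rewrite expn_gt0; apply/orP; left; near: n; exists 1%N.
  - rewrite -{1}[n]card_ord -card_inj_ffuns (leq_trans (max_card _)) //.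
    by rewrite card_ffun card_ord.
(* The limit exists, but this is not needed: the [lim] of a divergent sequence
   is [0]. *)
have [rho_cvg|/dvgP rho_dvg] := pselect (cvg (rho @ \oo)); last first.
  by rewrite /turan_density rho_dvg invr_gt0.
rewrite /turan_density -/rho; set L := lim _.
have tL := @cvg_ffact_ratio R N.
have rhoL : rho @ \oo --> L by [].
have rtL : (fun n => rho n * t n) @ \oo --> L.
  by rewrite -[X in _ --> X]mulr1; apply: cvgM.
(* Since [t] tends to 1, the contribution of non-injective maps vanishes in the limit. *)
have : L + 6 * M * L ^+ 2 <= 3 * M * L + 4 * M * (1 - 1).
  apply: ler_cvg_to rho_ineq.
    apply: cvgD => //; apply: cvgMr; rewrite expr2; apply: cvgM => //.
  apply: cvgD; apply: cvgMr => //; apply: cvgB => //; exact: cvg_cst.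
by rewrite subrr mulr0 addr0; apply: quadratic_lt_half.
Unshelve. all: by end_near. Qed.

(** * Attaining the maximum over three-edge hypergraphs *)

Lemma exists_three_edges r : (0 < r)%N ->
  exists E : {set {set 'I_(3 * r).+1}}, is_uniform r E && (#|E| == 3).
Proof.
move=> r_gt0; pose T : finType := 'I_(3 * r).+1.
pose D : {set {set T}} := [set e : {set T} | #|e| == r]%SET.
have D_ge3 : (3 <= #|D|)%N.
  rewrite /D card_draws card_ord.
  (* [r + 2] points suffice: C(r+2, r) = C(r+2, 2) >= C(3, 2) = 3. *)
  apply: leq_trans (leq_bin2l r (_ : r + 2 <= (3 * r).+1)%N); last by lia.
  rewrite -[X in 'C(_, X)](addnK 2) bin_sub ?leq_addl //.
  by apply: (@leq_trans 'C(3, 2)) => //; apply: leq_bin2l; lia.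
have := cards_draws D 3; have : (0 < 'C(#|D|, 3))%N by rewrite bin_gt0.
move=> /[swap] <- /card_gt0P[E]; rewrite inE => /andP[/fintype.subsetP sED E3].
exists E; rewrite E3 andbT; apply/forall_inP => e /sED.
by rewrite inE.
Qed.

Theorem theorem1p1 (R : realType) (r : nat) (r_gt0 : (0 < r)%N)
    (r_odd : odd r) :
  (exists g : R, is_gamma r g /\ g < 2^-1) /\
  (exists c : R, c < 2^-1 /\
     forall F : hypergraph r, #|edges F| = 3%N ->
       turan_density R (single F) <= c).
Proof.
suff [g gamma_g g_lt] : exists2 g : R, is_gamma r g & g < 2^-1.
  split; exists g; split=> // F F3; apply: gamma_g.2.
  by exists F.
(* Every three-edge hypergraph has the density of one on [(3 * r).+1] points; these form a finite
   type, so a maximum exists. *)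
pose core := {E : {set {set 'I_(3 * r).+1}} | is_uniform r E && (#|E| == 3)}.
pose hg (E : core) : hypergraph r := Hypergraph (proj1 (andP (valP E))).
have hg3 E : #|edges (hg E)| = 3 by case: (valP E) => /andP[_ /eqP].
pose dens E : R := turan_density R (single (hg E)).
have [E0 E0P] := exists_three_edges r_gt0.
have [E _ Emax] := @arg_maxP _ _ core (Sub E0 E0P) predT dens isT.
exists (dens E).
  split; first by exists (hg E).
  move=> _ [F [F3 ->]].
  have F0 : edges F != finset.set0 by rewrite -cards_eq0 F3.
  have [|E1 [E1_r E1_3 E1F]] :=
    @core_representative _ r (3 * r) _ r_gt0 (edges_uniform F) F0.
    by rewrite F3.
  rewrite F3 in E1_3.
  have E1P : is_uniform r E1 && (#|E1| == 3) by rewrite E1_r E1_3.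
  apply: le_trans (Emax (Sub E1 E1P) isT).
  rewrite le_eqVlt; apply/orP; left; apply/eqP.
  (* The two Turán numbers agree once [n] is at least [#|vertices F|] and exceeds [3 * r]. *)
  apply: lim_near_eq; near=> n; congr (_%:R / _); apply: turan_number_eq => G.
  rewrite E1F // card_ord.
    by near: n; exists #|vertices F|.
  by near: n; exists (3 * r).+1.
by apply: turan_density_lt_half => //; rewrite card_ord.
Unshelve. all: by end_near. Qed.
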